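(* Let $p$ be a prime and let $k$ be a field of characteristic $p$. The $k$-algebra $k[x,y,z]/\langle x^p-x,\; y^p-y,\; z^p-z\rangle$ (which is the underlying algebra of both the type A1 and the type C1) is isomorphic, as a $k$-algebra, to $k^{p^3}$, the direct product of $p^3$ copies of $k$.
   Context: A1 and C1 are names of two types of connected Hopf algebras of dimension $p^3$; only their underlying algebras, which coincide and are given explicitly in the claim, matter here. *)

(* Defs.v *)
From HB Require Import structures.
From mathcomp Require Import all_boot all_algebra generic_quotient ring_quotient.
From mathcomp Require Import boolp mpoly.

Set Implicit Arguments.
Unset Strict Implicit.
Unset Printing Implicit Defensive.

Import GRing.Theory.
Local Open Scope ring_scope.
Local Open Scope quotient_scope.

(* MathComp equips {ideal_quot I} with a ring structure only. *)
Section IdealQuotAlgebra.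
Variables (R : comNzRingType) (A : comAlgType R) (I : idealr A).
Local Notation Q := {ideal_quot I}.

Definition quot_scale (a : R) (u : Q) : Q := \pi_Q (a *: repr u).

Lemma quot_scale_pi (a : R) (f : A) : quot_scale a (\pi_Q f) = \pi_Q (a *: f).
Proof.
apply/eqP; rewrite /quot_scale -Quotient.idealrBE -scalerBr -mulr_algl.
by apply: idealMr; rewrite Quotient.idealrBE reprK.
Qed.

Fact quot_scalerA a b (u : Q) :
  quot_scale a (quot_scale b u) = quot_scale (a * b) u.
Proof. by elim/quotW: u => f; rewrite (quot_scale_pi b) !quot_scale_pi scalerA. Qed.

Fact quot_scale1r : left_id 1 quot_scale.
Proof. by elim/quotW=> f; rewrite quot_scale_pi scale1r. Qed.

Fact quot_scalerDr : right_distributive quot_scale +%R.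
Proof.
move=> a; elim/quotW=> f; elim/quotW=> g.
by rewrite -raddfD !quot_scale_pi scalerDr raddfD.
Qed.

Fact quot_scalerDl u : {morph quot_scale^~ u : a b / a + b}.
Proof.
by move=> a b; elim/quotW: u => f; rewrite !quot_scale_pi scalerDl raddfD.
Qed.

HB.instance Definition _ := GRing.Zmodule_isLmodule.Build R Q
  quot_scalerA quot_scale1r quot_scalerDr quot_scalerDl.

Fact quot_scalerAl (a : R) (u v : Q) : a *: (u * v) = (a *: u) * v.
Proof.
have scaleE f : a *: \pi_Q f = \pi_Q (a *: f) := quot_scale_pi a f.
elim/quotW: u => f; elim/quotW: v => g.
by rewrite -rmorphM (scaleE (f * g)) (scaleE f) scalerAl rmorphM.
Qed.

HB.instance Definition _ := GRing.Lmodule_isLalgebra.Build R Q quot_scalerAl.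
HB.instance Definition _ := GRing.Lalgebra_isComAlgebra.Build R Q.

End IdealQuotAlgebra.

Definition ideal_gen (A : comNzRingType) (s : seq A) : {pred A} :=
  fun f => `[< exists c : 'I_(size s) -> A, f = \sum_i c i * s`_i >].

Section ArtinSchreierIdeal.
Variables (k : fieldType) (p : nat).

Definition AS_ideal : {pred {mpoly k[3]}} :=
  let x := 'X_0 in let y := 'X_1 in let z := 'X_2 in
  ideal_gen [:: x ^+ p - x; y ^+ p - y; z ^+ p - z].

(* idealr also demands 1 \notin AS_ideal: every generator vanishes at (1, 1, 1). *)
Fact AS_ideal_closed : idealr_closed AS_ideal.
Proof.
split=> [||a f g /asboolP[c ->] /asboolP[d ->]].
- by apply/asboolP; exists (fun=> 0); rewrite big1 // => i _; rewrite mul0r.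
- apply/asboolP=> -[c /(congr1 (mpoly.meval (fun=> 1)))/eqP].
  rewrite rmorph1 rmorph_sum !big_ord_recl big_ord0 /=.
  rewrite !(rmorphM, rmorphB, rmorphXn) /= !mevalXU expr1n subrr !mulr0 !addr0.
  by rewrite oner_eq0.
- apply/asboolP; exists (fun i => a * c i + d i).
  rewrite mulr_sumr -big_split; apply: eq_bigr => i _.
  by rewrite mulrDl mulrA.
Qed.

HB.instance Definition _ := isIdealr.Build {mpoly k[3]} AS_ideal
  AS_ideal_closed.

End ArtinSchreierIdeal.
Arguments AS_ideal : clear implicits.

(* Main.v *)
(* For a root [x] of [X^p - X] in a commutative [k]-algebra and [a] in [F_p], set
   [e_a(x) = 1 - (x - a)^(p-1)].  Then [x e_a(x) = a e_a(x)] by Frobenius, and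
   the [e_a(x)] sum to 1, because the polynomial [\sum_a e_a(X) - 1] has degree
   less than [p] and vanishes on [F_p].  Multiplying over the three coordinates
   gives elements [e_c], [c] in [F_p^3], of the quotient, with sum 1 and
   [f e_c = f(c) e_c]; hence [f = \sum_c f(c) e_c], and evaluation at the points
   of [F_p^3] is inverse to [g |-> \sum_c g(c) e_c]. *)
From HB Require Import structures.
Require Import Defs.
From mathcomp Require Import all_boot all_algebra generic_quotient ring_quotient.
From mathcomp Require Import boolp mpoly.
Import GRing.Theory.
Local Open Scope ring_scope.

Set Implicit Arguments.
Unset Strict Implicit.
Unset Printing Implicit Defensive.

(** * Indicator elements of residues and of points with residue coordinates *)

Section Residues.
Variables (p : nat) (k : fieldType).
Hypothesis p_char : p \in [pchar k].

Definition residue_indicator (A : comAlgType k) (a : 'I_p) (x : A) : A :=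
  1 - (x - a%:R) ^+ p.-1.

Lemma rmorph_residue_indicator (A B : comAlgType k) (f : {rmorphism A -> B})
    (a : 'I_p) (x : A) :
  f (residue_indicator a x) = residue_indicator a (f x).
Proof. by rewrite rmorphB rmorphXn rmorphB rmorph1 rmorph_nat. Qed.

(** ['I_p] thus embeds in [k] as the prime field: two representatives differ by less than [p], so
    [p] divides the difference only when it is zero. *)
Lemma residue_natr_eq (a b : 'I_p) : (a%:R == b%:R :> k) = (a == b).
Proof.
wlog le_ab : a b / (a <= b)%N => [th|].
  by case: (leqP a b) => [/th //|/ltnW /th]; rewrite eq_sym [RHS]eq_sym.
rewrite eq_sym -subr_eq0 -natrB // -(dvdn_pcharf p_char) -val_eqE /=.
case: (posnP (b - a)) => [ba0|ba_gt0].
  by rewrite ba0 dvdn0 eqn_leq le_ab -subn_eq0 ba0.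
have -> : (a == b :> nat) = false by apply: ltn_eqF; rewrite -subn_gt0.
rewrite gtnNdvd //.
exact: leq_ltn_trans (leq_subr _ _) (ltn_ord b).
Qed.

Lemma residue_Frobenius (A : lalgType k) (a : nat) : a%:R ^+ p = a%:R :> A.
Proof.
have pA : p \in [pchar A] by rewrite pchar_lalg.
by rewrite -(pFrobenius_autE pA) pFrobenius_aut_nat.
Qed.

(** The difference of the two sides is [(x - a) - (x - a) ^+ p], and the additive Frobenius map
    fixes both [x] and [a%:R]. *)
Lemma residue_indicatorM (A : comAlgType k) (a : 'I_p) (x : A) :
  x ^+ p = x -> x * residue_indicator a x = a%:R * residue_indicator a x.
Proof.
have pA : p \in [pchar A] by rewrite pchar_lalg.
move=> xp; apply/eqP; rewrite -subr_eq0 -mulrBl mulrBr mulr1 -exprS.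
rewrite (prednK (prime_gt0 (pcharf_prime p_char))) -(pFrobenius_autE pA).
by rewrite rmorphB /= !pFrobenius_autE xp residue_Frobenius subrr.
Qed.

Lemma residue_indicator_nat (a b : 'I_p) :
  residue_indicator a (b%:R : k^o) = (a == b)%:R.
Proof.
have [->|neq_ab] := eqVneq a b.
  (* On the diagonal, [0 ^+ p.-1] vanishes because [p] is at least 2. *)
  rewrite /residue_indicator subrr expr0n -leqn0 leqNgt -ltnS.
  by rewrite prednK ?prime_gt1 ?prime_gt0 ?(pcharf_prime p_char) // subr0.
have /eqP := residue_indicatorM a (residue_Frobenius k^o b).
rewrite -subr_eq0 -mulrBl mulf_eq0 subr_eq0 residue_natr_eq eq_sym.
by rewrite (negbTE neq_ab) => /eqP.
Qed.

Lemma sum_residue_indicator (A : comAlgType k) (x : A) :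
  \sum_(a < p) residue_indicator a x = 1.
Proof.
pose q : {poly k} := \sum_(a < p) residue_indicator a 'X - 1.
(* The identity is proved once, for the variable of [{poly k}], and specialized at [x]. *)
have -> : \sum_(a < p) residue_indicator a x = horner_alg x (q + 1).
  rewrite subrK raddf_sum; apply: eq_bigr => a _.
  apply: etrans (esym (rmorph_residue_indicator (horner_alg x) a 'X)).
  by rewrite /= horner_algX.
suff -> : q = 0 by rewrite add0r rmorph1.
apply/eqP; apply: contraT => q_neq0.
have p_gt0 := prime_gt0 (pcharf_prime p_char).
have := @max_poly_roots k q [seq a%:R | a : 'I_p <- enum 'I_p] q_neq0.
rewrite size_map size_enum_ord ltnNge.
(* [size] is the degree plus one, so this bound contradicts [p] distinct roots. *)
have -> : (size q <= p)%N.
  rewrite (leq_trans (size_polyD _ _)) // geq_max size_polyN size_poly1 p_gt0.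
  rewrite andbT (leq_trans (size_sum _ _ _)) //; apply/bigmax_leqP => a _.
  rewrite (leq_trans (size_polyD _ _)) // geq_max size_polyN size_poly1 p_gt0.
  by rewrite -polyC_natr size_exp_XsubC prednK /=.
apply.
  apply/allP => _ /mapP[b _ ->]; rewrite /root -horner_evalE rmorphB rmorph1.
  rewrite rmorph_sum (bigD1 b) //= big1 ?addr0 => [|a neq_ab].
    rewrite (@rmorph_residue_indicator _ k^o (horner_eval b%:R)).
    by rewrite /= horner_evalE hornerX residue_indicator_nat eqxx subrr.
  rewrite (@rmorph_residue_indicator _ k^o (horner_eval b%:R)).
  by rewrite /= horner_evalE hornerX residue_indicator_nat (negbTE neq_ab).
by rewrite map_inj_uniq ?enum_uniq // => a b /eqP; rewrite residue_natr_eq => /eqP.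
Qed.

Variable n : nat.

Definition residue_point (c : {ffun 'I_n -> 'I_p}) : 'I_n -> k :=
  fun i => (c i)%:R.

Definition point_indicator (A : comAlgType k) (c : {ffun 'I_n -> 'I_p})
  (x : 'I_n -> A) : A := \prod_i residue_indicator (c i) (x i).

Lemma sum_point_indicator (A : comAlgType k) (x : 'I_n -> A) :
  \sum_c point_indicator c x = 1.
Proof.
(* Distributivity factors the sum over points into one sum per coordinate. *)
rewrite -(bigA_distr_bigA (fun i a => residue_indicator a (x i))).
by rewrite big1 // => i _; rewrite sum_residue_indicator.
Qed.

(** The indicator is a common eigenvector for multiplication by the images of the variables.
    Eigenvalues multiply along monomials, and linearity does the rest. *)
Lemma point_indicatorM (A : comAlgType k) (pi : {lrmorphism {mpoly k[n]} -> A})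
    (c : {ffun 'I_n -> 'I_p}) (f : {mpoly k[n]}) :
  (forall i, pi 'X_i ^+ p = pi 'X_i) ->
  pi f * point_indicator c (fun i => pi 'X_i) =
  f.@[residue_point c] *: point_indicator c (fun i => pi 'X_i).
Proof.
move=> piX; set e := point_indicator _ _.
have Xe i : pi 'X_i * e = (residue_point c i)%:A * e.
  rewrite /e /point_indicator (bigD1 i) //= !mulrA residue_indicatorM //.
  by rewrite scaler_nat.
have Xne i m : pi 'X_i ^+ m * e = (residue_point c i ^+ m)%:A * e.
  elim: m => [|m IH]; first by rewrite !expr0 scale1r.
  by rewrite exprSr -mulrA Xe mulrCA IH exprS -!scalerAl !mul1r scalerA.
rewrite {1}[f]mpolyE (linear_sum pi) mulr_suml mevalE scaler_suml.
apply: eq_bigr => m _.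
rewrite (linearZ_LR pi) -scalerAl -scalerA; congr (_ *: _).
rewrite mpolyXE_id rmorph_prod /=.
elim/big_rec2: _ => [|i y z _ IH]; first by rewrite mul1r scale1r.
rewrite rmorphXn /= -mulrA IH -scalerAr Xne -scalerAl mul1r scalerA.
by rewrite mulrC.
Qed.
End Residues.

(** * Evaluation of the quotient algebra at residue points *)

Section Evaluation.
Variables (p : nat) (k : fieldType).
Hypothesis p_char : p \in [pchar k].

Local Notation A := {ideal_quot (AS_ideal k p)}.
Local Notation piA := (\pi_A%qT : {mpoly k[3]} -> A).

(** This makes the projection an [{lrmorphism}], as [point_indicatorM] requires. *)
Fact piA_scalable : scalable piA.
Proof. by move=> a f; rewrite -quot_scale_pi. Qed.

HB.instance Definition _ :=
  GRing.isScalable.Build k {mpoly k[3]} A *:%R piA piA_scalable.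

Lemma piA_Frobenius (i : 'I_3) : piA 'X_i ^+ p = piA 'X_i.
Proof.
rewrite -rmorphXn; apply/eqP; rewrite -Quotient.idealrBE; apply/asboolP.
(* Kronecker coefficients select the generator in the variable ['X_i]. *)
exists (fun j : 'I_3 => (j == i)%:R).
rewrite (bigD1 i) //= eqxx mul1r big1 ?addr0 => [|j /negbTE->].
  by case: i => [[|[|[|]]] //= ?]; congr ('X_(_) ^+ p - 'X_(_));
    apply: val_inj.
by rewrite mul0r.
Qed.

Lemma meval_AS_ideal (c : {ffun 'I_3 -> 'I_p}) (f : {mpoly k[3]}) :
  f \in AS_ideal k p -> f.@[residue_point k c] = 0.
Proof.
move=> /asboolP[d ->]; rewrite !big_ord_recl big_ord0 /=.
rewrite !(mevalD, meval0, mevalM, mevalN, rmorphXn) /= !mevalXU.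
have Frob i : residue_point k c i ^+ p = residue_point k c i.
  exact: (residue_Frobenius p_char k^o).
by rewrite !Frob !subrr !mulr0 !addr0.
Qed.

(** Evaluation descends to the quotient: two representatives of a class differ by an element of the
    ideal. *)
Lemma meval_repr (c : {ffun 'I_3 -> 'I_p}) (f : {mpoly k[3]}) :
  (repr (piA f)).@[residue_point k c] = f.@[residue_point k c].
Proof.
apply/eqP; rewrite -subr_eq0 -mevalB; apply/eqP/meval_AS_ideal.
by rewrite Quotient.idealrBE reprK.
Qed.

Lemma piA_sum_point_indicator (f : {mpoly k[3]}) :
  piA f = \sum_(c : {ffun 'I_3 -> 'I_p}) f.@[residue_point k c] *:
            point_indicator c (fun i => piA 'X_i).
Proof.
rewrite -[LHS]mulr1 -(sum_point_indicator p_char (fun i => piA 'X_i)) mulr_sumr.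
by apply: eq_bigr => c _; apply: point_indicatorM => //; apply: piA_Frobenius.
Qed.

Lemma meval_point_indicator (c d : {ffun 'I_3 -> 'I_p}) :
  (point_indicator c (fun i => 'X_i : {mpoly k[3]})).@[residue_point k d]
  = (c == d)%:R.
Proof.
(* The codomain is [k^o] because indicators live in [k]-algebras. *)
pose ev : {rmorphism {mpoly k[3]} -> k^o} := meval (residue_point k d).
transitivity (\prod_i (c i == d i)%:R : k).
  rewrite rmorph_prod; apply: eq_bigr => i _.
  rewrite (rmorph_residue_indicator ev) /= mevalXU.
  exact: residue_indicator_nat.
have [->|neq_cd] := eqVneq c d; first by rewrite big1 // => i _; rewrite eqxx.
have [i neq_i] : exists i, c i != d i.
  apply/existsP; apply: contraNT neq_cd => /existsPn eq_cd.
  by apply/eqP/ffunP => i; apply/eqP; rewrite -[_ == _]negbK.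
by rewrite (bigD1 i) //= (negbTE neq_i) mul0r.
Qed.

Variables (N : nat) (c : 'I_N -> {ffun 'I_3 -> 'I_p}).

Definition residue_eval (u : A) : {ffun 'I_N -> k^o} :=
  [ffun j => (repr u).@[residue_point k (c j)]].

Lemma residue_eval_pi f j : residue_eval (piA f) j = f.@[residue_point k (c j)].
Proof. by rewrite ffunE meval_repr. Qed.

Fact residue_eval_zmod : zmod_morphism residue_eval.
Proof.
elim/quotW=> f; elim/quotW=> g; rewrite -rmorphB; apply/ffunP => j.
by rewrite !ffunE !meval_repr mevalB.
Qed.

Fact residue_eval_monoid : monoid_morphism residue_eval.
Proof.
split.
  by apply/ffunP => j; rewrite -(rmorph1 piA) !ffunE meval_repr meval1.
elim/quotW=> f; elim/quotW=> g; rewrite -rmorphM; apply/ffunP => j.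
by rewrite !ffunE !meval_repr mevalM.
Qed.

Fact residue_eval_scalable : scalable residue_eval.
Proof.
move=> a; elim/quotW=> f; rewrite -(linearZ_LR piA); apply/ffunP => j.
by rewrite !ffunE !meval_repr mevalZ.
Qed.

HB.instance Definition _ :=
  GRing.isZmodMorphism.Build _ _ residue_eval residue_eval_zmod.
HB.instance Definition _ :=
  GRing.isMonoidMorphism.Build _ _ residue_eval residue_eval_monoid.
HB.instance Definition _ :=
  GRing.isScalable.Build k _ _ *:%R residue_eval residue_eval_scalable.

Lemma residue_eval_bij : bijective c -> bijective residue_eval.
Proof.
case=> c' cK c'K.
pose E (d : {ffun 'I_3 -> 'I_p}) : {mpoly k[3]} :=
  point_indicator d (fun i => 'X_i).
(* The inverse is Lagrange interpolation: the class of the polynomial taking the value [g (c' d)] at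
   each point [d]. *)
exists (fun g : {ffun 'I_N -> k^o} => piA (\sum_d g (c' d) *: E d)).
  elim/quotW=> f; rewrite [RHS]piA_sum_point_indicator linear_sum.
  apply: eq_bigr => d _.
  rewrite linearZ residue_eval_pi c'K; congr (_ *: _).
  rewrite rmorph_prod; apply: eq_bigr => i _.
  exact: (@rmorph_residue_indicator p k {mpoly k[3]} A piA).
(* At the point [c j], only the summand [d = c j] survives. *)
move=> g; apply/ffunP => j; rewrite residue_eval_pi raddf_sum (bigD1 (c j)) //=.
rewrite big1 => [|d neq_d]; rewrite mevalZ meval_point_indicator.
  by rewrite eqxx mulr1 addr0 cK.
by rewrite (negbTE neq_d) mulr0.
Qed.

Lemma exists_lrmorphism_residue_eval :
  bijective c -> exists f : {lrmorphism A -> {ffun 'I_N -> k^o}}, bijective f.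
Proof. by exists residue_eval; apply: residue_eval_bij. Qed.

End Evaluation.

Theorem proposition3p1 (p : nat) (k : fieldType) (p_prime : prime p)
    (k_char : p \in [pchar k]) :
  exists f : {lrmorphism {ideal_quot (AS_ideal k p)} ->
                         {ffun 'I_(p ^ 3) -> k^o}},
    bijective f.
Proof.
have card_pts : (p ^ 3)%N = #|{ffun 'I_3 -> 'I_p}|.
  by rewrite card_ffun !card_ord.
(* The cast identifies ['I_(p ^ 3)] with the domain of [enum_val], whose bound is the cardinality of
   the set of points. *)
pose c (j : 'I_(p ^ 3)) : {ffun 'I_3 -> 'I_p} :=
  enum_val (cast_ord card_pts j).
apply: (exists_lrmorphism_residue_eval k_char (c := c)).
exact: bij_comp (@enum_val_bij _) (Bijective (cast_ordK _) (cast_ordKV _)).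
Qed.
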